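(* Let $p$ be an odd prime and $n$ a positive integer. Then $$S_{np+1}\equiv\begin{cases}(4+12n-9n^2)S_n\pmod{p^3} & \text{if } p=3,\\ 4(np+1)S_n+32n^2S_{n-1}(-1)^{\frac{p-1}{2}}(E_{p-3}-1)p^2\pmod{p^3} & \text{if } p>3.\end{cases}$$
   Context: $(S_n)_{n\ge0}$ is the integer sequence defined by $S_0=1$, $S_1=4$ and $(n+1)^2S_{n+1}=4(3n^2+3n+1)S_n-32n^2S_{n-1}$ for $n\ge1$; equivalently $S_n=\sum_{k=0}^n\binom nk\binom{2k}k\binom{2n-2k}{n-k}$. The Euler numbers $E_n$ are defined by $E_0=1$, $E_{2n-1}=0$ and $\sum_{k=0}^n\binom{2n}{2k}E_{2k}=0$ for $n\ge1$. *)

(* Defs.v *)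
From HB Require Import structures.
From mathcomp Require Import all_boot all_order all_algebra.
Set Implicit Arguments. Unset Strict Implicit. Unset Printing Implicit Defensive.
Import Order.TTheory GRing.Theory Num.Theory.

Definition S (n : nat) : nat :=
  \sum_(0 <= k < n.+1) 'C(n, k) * 'C(k.*2, k) * 'C((n - k).*2, n - k).

(* The list [E_0; E_2; ...; E_{2m}] of even-index Euler numbers, built from
   E_0 = 1 and sum_{k=0}^m C(2m,2k) E_{2k} = 0 for m >= 1. *)
Fixpoint euler_even_seq (m : nat) : seq int :=
  match m with
  | 0 => [:: 1%R]
  | m'.+1 =>
      let s := euler_even_seq m' in
      rcons s (- \sum_(k < m'.+1) ('C(m'.+1.*2, k.*2))%:Z * nth 0%R s k)%R
  end.

Definition Euler (m : nat) : int :=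
  if odd m then 0%R else nth 0%R (euler_even_seq m./2) m./2.

(* Main.v *)
Require Import Defs.
From HB Require Import structures.
From mathcomp Require Import all_boot all_order all_algebra.
From mathcomp Require Import zify ring.
Set Implicit Arguments. Unset Strict Implicit. Unset Printing Implicit Defensive.
Import Order.TTheory GRing.Theory Num.Theory.
Local Open Scope ring_scope.

(* Write F(n,k) for the summand of S_n. The recurrence at index np expresses
   S_{np+1} through S_{np} mod p^3 and S_{np-1} mod p; the latter is
   (-1)^((p-1)/2) S_{n-1} by the Lucas congruence. In S_{np} the terms k = pr give
   S_n, since C(np,rp) = C(n,r) mod p^3 for p > 3. If k = pr + s with 0 < s < p,
   then C(np,k) and exactly one of the two central binomial coefficients are
   divisible by p, so F(np,k) / p^2 only matters mod p, and these terms add up to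
   4 n^2 S_{n-1} p^2 sum_{0<s<p/2} (-1)^s / s^2. As 1/s^2 = s^(p-3) mod p, that sum
   telescopes through the Euler polynomial of degree p - 3, giving
   2 (-1)^((p-1)/2) E_{p-3}. For p = 3 the terms k = 3r are computed mod 27
   with a correction, which is evaluated by a second moment of F. *)

(** * Recurrence *)

Lemma mulS_central_bin (k : nat) :
  (k.+1 * 'C(k.+1.*2, k.+1) = 2 * k.*2.+1 * 'C(k.*2, k))%N.
Proof.
have h1 := mul_bin_diag k.*2.+1 k.
have h2 := mul_bin_down k.*2.+1 k.
have -> : k.+1.*2 = k.*2.+2 by lia.
have h3 := binS k.*2.+1 k.
have h4 : 'C(k.*2.+1, k.+1) = 'C(k.*2.+1, k).
  by rewrite -bin_sub; [congr binomial; lia | lia].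
rewrite h3 h4 -h4 /=.
rewrite /= in h1 h2; nia.
Qed.

(** The summand of S_n is n! a_k a_(n-k) for these a_k, so S_n / n! is a self-convolution. *)
Definition expcoef (k : nat) : rat := ('C(k.*2, k))%:R / (k`!)%:R.

Lemma natr_fact_neq0 (R : numDomainType) (n : nat) : (n`!)%:R != 0 :> R.
Proof. by rewrite pnatr_eq0 -lt0n fact_gt0. Qed.

Lemma expcoefS (k : nat) :
  k.+1%:R ^+ 2 * expcoef k.+1 = (4 * k%:R + 2) * expcoef k.
Proof.
rewrite /expcoef factS natrM.
have h := congr1 (fun n => n%:R : rat) (mulS_central_bin k).
rewrite /= !natrM in h.
have k0 : k.+1%:R != 0 :> rat by rewrite pnatr_eq0.
have f0 := @natr_fact_neq0 rat k.
have -> : k.+1%:R ^+ 2 * (('C(k.+1.*2, k.+1))%:R / (k.+1%:R * (k`!)%:R))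
   = (k.+1%:R * ('C(k.+1.*2, k.+1))%:R) / (k`!)%:R :> rat.
  by field; rewrite f0 nat1r k0.
rewrite h -[k.*2.+1]addn1 natrD -muln2 natrM; field; exact: f0.
Qed.

Definition conv (c : nat -> nat -> rat) (n : nat) : rat :=
  \sum_(k < n.+1) c k (n - k)%N * (expcoef k * expcoef (n - k)).

Lemma eq_conv (c d : nat -> nat -> rat) (n : nat) :
  (forall i j, (i + j = n)%N -> c i j = d i j) -> conv c n = conv d n.
Proof.
by move=> h; apply: eq_bigr => k _; rewrite h // subnKC // -ltnS.
Qed.

Lemma convC (c : nat -> nat -> rat) (n : nat) :
  conv c n = conv (fun i j => c j i) n.
Proof.
rewrite /conv (reindex_inj rev_ord_inj) /=; apply: eq_bigr => k _.
rewrite subSS subKn; last by rewrite -ltnS.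
by rewrite [expcoef k * _]mulrC.
Qed.

Lemma convD (c d : nat -> nat -> rat) (n : nat) :
  conv (fun i j => c i j + d i j) n = conv c n + conv d n.
Proof. by rewrite /conv -big_split; apply: eq_bigr => k _; rewrite mulrDl. Qed.

Lemma convZ (a : rat) (c : nat -> nat -> rat) (n : nat) :
  conv (fun i j => a * c i j) n = a * conv c n.
Proof. by rewrite /conv mulr_sumr; apply: eq_bigr => k _; rewrite -mulrA. Qed.

(** The factor i^2 kills the term i = 0 and, after a shift of i, is absorbed by [expcoefS]. *)
Lemma conv_sqr (g : nat -> rat) (n : nat) :
  conv (fun i j => i%:R ^+ 2 * g j) n.+1 =
  conv (fun i j => (4 * i%:R + 2) * g j) n.
Proof.
rewrite /conv big_ord_recl /= expr0n !mul0r add0r.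
apply: eq_bigr => k _; rewrite /bump /= add1n subSS.
have := expcoefS k; set x := k.+1%:R; set y := expcoef k.+1 => h.
transitivity ((x ^+ 2 * y) * (g (n - k)%N * expcoef (n - k))); first by ring.
by rewrite h; ring.
Qed.

Definition Sterm (n k : nat) : nat :=
  ('C(n, k) * 'C(k.*2, k) * 'C((n - k).*2, n - k))%N.

Lemma Sterm_conv (c : nat -> nat -> nat) (n : nat) :
  (\sum_(0 <= k < n.+1) c k (n - k) * Sterm n k)%N%:R =
  (n`!)%:R * conv (fun i j => (c i j)%:R) n.
Proof.
rewrite /conv big_mkord natr_sum mulr_sumr; apply: eq_bigr => k _.
have kn : (k <= n)%N by rewrite -ltnS.
rewrite /expcoef /Sterm !natrM -(bin_fact kn) !natrM.
have := @natr_fact_neq0 rat k; have := @natr_fact_neq0 rat (n - k) => h1 h2.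
by field; rewrite h1 h2.
Qed.

Lemma S_conv (n : nat) : (S n)%:R = (n`!)%:R * conv (fun _ _ => 1) n.
Proof.
rewrite -(Sterm_conv (fun _ _ => 1%N)); congr _%:R.
by apply: eq_bigr => k _; rewrite mul1n.
Qed.

Section Recurrence.

(* With a_k = C(2k,k)/k!, the generating function A of (a_k) satisfies
   D^2 A = x (4 D A + 2 A) for D = x d/dx. The convolutions below are the
   coefficients of A^2, A.DA and (DA)^2; eliminating the last two yields the
   recurrence of S. *)
Let u := conv (fun _ _ => 1).
Let v := conv (fun i _ => i%:R).
Let w := conv (fun i j => i%:R * j%:R).

Let natr_rat_inj : injective (fun i : nat => i%:R : rat).
Proof. by move=> i j /eqP; rewrite eqr_nat => /eqP. Qed.

Let natr_degree i j m : (i + j = m)%N -> m%:R = i%:R + j%:R :> rat.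
Proof. by move=> <-; rewrite natrD. Qed.

(** This relation and the next two write m = i + j, which is the Leibniz rule for D; squares then
    lower the index through [conv_sqr]. *)
Let eu m : m%:R * u m = 2 * v m.
Proof.
rewrite /u -convZ.
rewrite (@eq_conv _ (fun i j => i%:R + j%:R)); last first.
  by move=> i j /natr_degree ->; rewrite mulr1.
by rewrite convD -[conv (fun _ j => j%:R) m]convC -/v; ring.
Qed.

Let ev m : m.+1%:R * v m.+1 = w m.+1 + 4 * v m + 2 * u m.
Proof.
rewrite /v -convZ.
rewrite (@eq_conv _ (fun i j => i%:R * j%:R + i%:R ^+ 2 * 1)); last first.
  by move=> i j /natr_degree ->; ring.
rewrite convD conv_sqr -/w -addrA; congr (_ + _).
rewrite -/v /u /v -!convZ -convD; apply: eq_conv => i j _; ring.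
Qed.

Let ew m : m.+1%:R * w m.+1 = 8 * w m + 4 * v m.
Proof.
rewrite /w -convZ.
rewrite (@eq_conv _ (fun i j => i%:R ^+ 2 * j%:R + j%:R ^+ 2 * i%:R)); last first.
  by move=> i j /natr_degree ->; ring.
rewrite convD [X in _ + X]convC conv_sqr -/w.
rewrite (@eq_conv _ (fun i j => 4 * (i%:R * j%:R) + 2 * j%:R)); last first.
  by move=> i j _; ring.
by rewrite convD !convZ -/w -[conv (fun _ j => j%:R) m]convC -/v; ring.
Qed.

(** This is [ev] solved for w, with v eliminated by [eu]. It serves the correction for p = 3. *)
Lemma S_moment (n : nat) : (0 < n)%N ->
  (2 * (\sum_(0 <= k < n.+1) k * (n - k) * Sterm n k) + 4 * n ^ 2 * S n.-1 =
   n ^ 2 * S n)%N.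
Proof.
case: n => // n _; rewrite /=; apply: natr_rat_inj.
rewrite !(natrD, natrM, natrX) (Sterm_conv (fun i j => i * j)%N) !S_conv -/u.
rewrite (@eq_conv _ (fun i j => i%:R * j%:R)) -/w => [|i j _]; last by rewrite natrM.
have n1 : n.+1%:R = n%:R + 1 :> rat by rewrite -addn1 natrD.
move: (eu n.+1) (eu n) (ev n); rewrite factS natrM n1.
move: (u n.+1) (u n) (v n.+1) (v n) (w n.+1) (n%:R : rat) => u1 u0 v1 v0 w1 x.
move=> hu1 hu0 hv1.
have ew1 : w1 = (x + 1) * v1 - 4 * v0 - 2 * u0 by rewrite hv1; ring.
have ev1 : v1 = (x + 1) * u1 / 2 by rewrite hu1; field.
have ev0 : v0 = x * u0 / 2 by rewrite hu0; field.
by rewrite ew1 ev1 ev0; field.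
Qed.

Lemma S_rec (n : nat) : (0 < n)%N ->
  (n.+1 ^ 2 * S n.+1 + 32 * n ^ 2 * S n.-1 =
   4 * (3 * n ^ 2 + 3 * n + 1) * S n)%N.
Proof.
case: n => // n _; rewrite /=.
have n1 : n.+1%:R = n%:R + 1 :> rat by rewrite -addn1 natrD.
have n2 : n.+2%:R = n%:R + 2 :> rat by rewrite -addn2 natrD.
have hu2 := eu n.+2; have hu1 := eu n.+1; have hu0 := eu n.
have hv2 := ev n.+1; have hv1 := ev n.
have hw2 := ew n.+1.
(* The recurrence for u = S_n / n! at index n + 1, after division by (n+1)!. *)
have key : n.+2%:R ^+ 3 * u n.+2 + 32 * n.+1%:R * u n =
    4 * (3 * n.+1%:R ^+ 2 + 3 * n.+1%:R + 1) * u n.+1.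
  move: hu2 hu1 hu0 hv2 hv1 hw2; rewrite n2 n1.
  move: (u n.+2) (u n.+1) (u n) (v n.+2) (v n.+1) (v n) (w n.+2) (w n.+1) (n%:R : rat).
  move=> u2 u1 u0 v2 v1 v0 w2 w1 x hu2 hu1 hu0 hv2 hv1 hw2.
  have ev1 : v1 = (x + 1) * u1 / 2 by rewrite hu1; field.
  have ev0 : v0 = x * u0 / 2 by rewrite hu0; field.
  have ew1 : w1 = (x + 1) * v1 - 4 * v0 - 2 * u0 by rewrite hv1; ring.
  have ew2 : w2 = (x + 2) * v2 - 4 * v1 - 2 * u1 by rewrite hv2; ring.
  (* [hu2], [hv2] and [hw2] are applied in turn, each using up one factor n + 2. *)
  have -> : (x + 2) ^+ 3 * u2 = 2 * ((x + 2) * ((x + 2) * v2)).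
    by rewrite exprS -mulrA [(x+2)^+2]expr2 -[(x+2)*(x+2)*u2]mulrA hu2; ring.
  have -> : (x + 2) * ((x + 2) * v2) = (x + 2) * w2 + (x + 2) * (4 * v1 + 2 * u1).
    by rewrite hv2; ring.
  by rewrite hw2 ew1 ev1 ev0; field.
apply: natr_rat_inj.
rewrite !(natrD, natrM, natrX) !S_conv -/u !factS !natrM.
set f := (n`!)%:R.
transitivity ((n.+2%:R ^+ 3 * u n.+2 + 32 * n.+1%:R * u n) * (n.+1%:R * f)).
  by rewrite n1 n2; ring.
by rewrite key; ring.
Qed.

End Recurrence.

(** * Lucas congruence *)

(** Since p divides C(p,i) for 0 < i < p, Vandermonde's sum keeps only the terms i = 0 and i = p. *)
Lemma bin_prime_add (R : nzRingType) (p m k : nat) : p \in [pchar R] ->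
  ('C(p + m, k))%:R = ('C(m, k))%:R + (if (p <= k)%N then 'C(m, k - p) else 0%N)%:R :> R.
Proof.
move=> hp; have p_pr := pcharf_prime hp; have p0 := prime_gt0 p_pr.
rewrite -binomial.Vandermonde natr_sum big_ord_recl bin0 mul1n subn0; congr (_ + _).
have mid (i : nat) : (0 < i < p)%N -> ('C(p, i) * 'C(m, k - i))%:R = 0 :> R.
  move=> hi; apply/eqP; rewrite -(dvdn_pcharf hp) dvdn_mulr //.
  exact: prime_dvd_bin.
have hi (i : nat) : (p < i)%N -> ('C(p, i) * 'C(m, k - i))%:R = 0 :> R.
  by move=> h; rewrite bin_small.
case: leqP => pk.
  have lt : (p.-1 < k)%N by lia.
  rewrite (bigD1 (Ordinal lt)) //= /bump /= add1n prednK // binn mul1n big1 ?addr0 //.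
  move=> i; rewrite -val_eqE /= => ne; rewrite add1n.
  have [h|h] := leqP i.+1 p; [apply: mid; lia | exact: hi].
rewrite big1 // => i _; rewrite /= /bump /= add1n; apply: mid.
by have := ltn_ord i; lia.
Qed.

(** Induction on a: splitting one p off the top index turns into Pascal's rule for C(a,c). *)
Lemma Lucas (R : nzRingType) (p a b c d : nat) : p \in [pchar R] ->
  (b < p)%N -> (d < p)%N ->
  ('C(a * p + b, c * p + d))%:R = ('C(a, c))%:R * ('C(b, d))%:R :> R.
Proof.
move=> hp bp dp; elim: a c => [|a IH] c.
  rewrite mul0n add0n; case: c => [|c]; first by rewrite mul0n bin0 mul1r.
  by rewrite bin0n mul0r bin_small //; nia.
rewrite mulSn -addnA bin_prime_add //.
case: c => [|c].
  rewrite (IH 0%N) !bin0 leqNgt mul0n add0n dp addr0 //.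
rewrite IH mulSn -addnA leq_addr addKn IH binS natrD mulrDl //.
Qed.

Lemma natr_pchar_neq0 (F : fieldType) (p s : nat) : p \in [pchar F] ->
  (0 < s < p)%N -> s%:R != 0 :> F.
Proof. by move=> hp hs; rewrite -(dvdn_pcharf hp) gtnNdvd //; lia. Qed.

Lemma natr_fermat (F : fieldType) (p s : nat) : p \in [pchar F] ->
  (0 < s < p)%N -> s%:R ^+ p.-1 = 1 :> F.
Proof.
move=> hp hs; apply: (mulfI (natr_pchar_neq0 hp hs)).
rewrite -exprS prednK ?prime_gt0 ?(pcharf_prime hp) // mulr1.
by rewrite -(pFrobenius_autE hp) pFrobenius_aut_nat.
Qed.

(** * Reduction of S_{np} and S_{np-1} *)

Lemma Sterm_sym (n k : nat) : (k <= n)%N -> Sterm n (n - k) = Sterm n k.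
Proof. by move=> kn; rewrite /Sterm bin_sub // subKn // mulnAC. Qed.

(** Pairing r with n - r averages the weight: (2(n-r)+1) + (2r+1) = 2(n+1). *)
Lemma S_weighted (n : nat) :
  (\sum_(0 <= r < n.+1) Sterm n r * (n - r).*2.+1 = n.+1 * S n)%N.
Proof.
apply/eqP; rewrite -(eqn_pmul2l (isT : 0 < 2)%N); apply/eqP.
rewrite mul2n -addnn {1}big_nat_rev /= -big_split /= mulnA big_distrr /=.
apply: eq_big_nat => r hr; rewrite add0n subSS -/(Sterm n r).
by rewrite Sterm_sym ?subKn -?mulnDr ?[(Sterm _ _ * _)%N]mulnC; [congr muln; lia|lia..].
Qed.

Lemma big_nat_blocks (f : nat -> nat) (n p : nat) :
  (\sum_(0 <= k < n * p) f k = \sum_(0 <= r < n) \sum_(0 <= s < p) f (r * p + s))%N.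
Proof.
elim: n => [|n IH]; first by rewrite !big_geq.
rewrite mulSn addnC (big_cat_nat _ (n := (n * p)%N)) ?leq_addr //= IH.
rewrite big_nat_recr //=; congr addn.
rewrite -{1}[(n * p)%N]add0n big_addn addKn.
by apply: eq_bigr => s _; rewrite addnC.
Qed.

Section CharP.
Variables (F : fieldType) (p : nat).
Hypotheses (hp : p \in [pchar F]) (hodd : odd p).

Let p_pr : prime p := pcharf_prime hp.
Let p_gt1 : (1 < p)%N := prime_gt1 p_pr.
Let natrp0 : p%:R = 0 :> F := pcharf0 hp.

Lemma natrDMp (a s : nat) : (a * p + s)%:R = s%:R :> F.
Proof. by rewrite natrD natrM natrp0 mulr0 add0r. Qed.

(** Pascal's rule and C(p,s+1) = 0 flip the sign at each step. *)
Lemma bin_pred_pchar (s : nat) : (s < p)%N -> ('C(p.-1, s))%:R = (-1) ^+ s :> F.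
Proof.
elim: s => [|s IH] sp; first by rewrite bin0.
have h := binS p.-1 s; rewrite prednK in h; last by lia.
have : ('C(p, s.+1))%:R = 0 :> F.
  by apply/eqP; rewrite -(dvdn_pcharf hp) prime_dvd_bin.
rewrite h natrD IH; last lia.
by move/eqP; rewrite addr_eq0 => /eqP ->; rewrite exprS mulN1r.
Qed.

Lemma fact_pchar_neq0 (s : nat) : (s < p)%N -> (s`!)%:R != 0 :> F.
Proof.
elim: s => [|s IH] sp; first exact: oner_neq0.
by rewrite factS natrM mulf_neq0 ?IH 1?ltnW // (natr_pchar_neq0 hp).
Qed.

Lemma central_bin_neq0 (s : nat) : (s <= p./2)%N -> ('C(s.*2, s))%:R != 0 :> F.
Proof.
move=> hs; have ss : (s <= s.*2)%N by lia.
have := @fact_pchar_neq0 s.*2; rewrite -(bin_fact ss) natrM mulf_eq0 negb_or.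
by move=> h; have /andP[] := h ltac:(lia).
Qed.

Lemma central_bin_lucas (r s : nat) : (s <= p./2)%N ->
  ('C((r * p + s).*2, r * p + s))%:R = ('C(r.*2, r))%:R * ('C(s.*2, s))%:R :> F.
Proof.
move=> hs; have -> : ((r * p + s).*2 = r.*2 * p + s.*2)%N by lia.
by rewrite (Lucas _ _ hp) //; lia.
Qed.

(** Doubling s now carries in base p, and the remaining low digit 2s - p is smaller than s. *)
Lemma central_bin_eq0 (r s : nat) : (p./2 < s < p)%N ->
  ('C((r * p + s).*2, r * p + s))%:R = 0 :> F.
Proof.
move=> hs; have -> : ((r * p + s).*2 = r.*2.+1 * p + (s.*2 - p))%N by lia.
rewrite (Lucas _ _ hp); [|lia..].
by rewrite ['C(_ - _, _)]bin_small ?mulr0 //; lia.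
Qed.

(** For k = rp + s the low digits of k and np - 1 - k add up to p - 1, so a central coefficient
    vanishes unless s = (p-1)/2. *)
Lemma S_pred_mul (n : nat) : (0 < n)%N ->
  (S (n * p - 1))%:R = (-1) ^+ p./2 * (S n.-1)%:R :> F.
Proof.
move=> n0; have np0 : (0 < n * p)%N by rewrite muln_gt0 n0 prime_gt0.
rewrite {1}/S subn1 prednK // big_nat_blocks /S prednK // natr_sum natr_sum mulr_sumr.
apply: eq_big_nat => r hr; rewrite natr_sum.
have e0 : (n * p).-1 = (n.-1 * p + p.-1)%N by nia.
rewrite (bigD1_seq p./2) ?mem_index_iota ?iota_uniq //=; last by lia.
rewrite big_seq_cond big1 ?addr0 => [|s].
  have e1 : ((n * p).-1 - (r * p + p./2) = (n.-1 - r) * p + p./2)%N by nia.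
  rewrite e1 e0 !natrM !central_bin_lucas // (Lucas _ _ hp); [|lia..].
  (* All three binomials contribute C(p-1,(p-1)/2), a sign whose cube is itself. *)
  have -> : (p./2.*2 = p.-1)%N by lia.
  rewrite bin_pred_pchar; last by lia.
  have := sqrr_sign F p./2.
  set x := (-1) ^+ _ => hx.
  rewrite -[X in _ = X * _]mul1r -hx; ring.
rewrite mem_index_iota => /andP[hs ne].
rewrite !natrM; have [sh|sh] := ltnP p./2 s.
  by rewrite central_bin_eq0 ?mulr0 ?mul0r //; lia.
have -> : ((n * p).-1 - (r * p + s) = (n.-1 - r) * p + (p.-1 - s))%N by nia.
by rewrite [X in _ * X]central_bin_eq0 ?mulr0 //; lia.
Qed.

(* w determines z modulo p^(j+1), so congruences modulo p^3 between multiples of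
   p^2 become identities in the field F. *)
Definition lead (j z : nat) (w : F) : Prop :=
  exists2 q, z = (p ^ j * q)%N & q%:R = w.

Lemma lead0 (z : nat) : lead 0 z z%:R.
Proof. by exists z; rewrite ?mul1n. Qed.

Lemma lead_mul (i j z z' : nat) (w w' : F) :
  lead i z w -> lead j z' w' -> lead (i + j) (z * z') (w * w').
Proof.
move=> [q -> <-] [q' -> <-]; exists (q * q')%N; last by rewrite natrM.
by rewrite expnD; ring.
Qed.

Lemma lead_sum (I : eqType) (r : seq I) (j : nat) (f : I -> nat) (g : I -> F) :
  (forall i, i \in r -> lead j (f i) (g i)) ->
  lead j (\sum_(i <- r) f i) (\sum_(i <- r) g i).
Proof.
elim: r => [|a r IH] h; first by exists 0%N; rewrite !big_nil ?muln0.
have [q eq1 eq2] := h a (mem_head _ _).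
have [q' eq1' eq2'] := IH (fun i hi => h i (mem_behead (s := a :: r) hi)).
by exists (q + q')%N; rewrite !big_cons ?eq1 ?eq1' ?mulnDr // natrD eq2 eq2'.
Qed.

Lemma natr_eq0_dvd (z : nat) : z%:R = 0 :> F -> exists q, z = (p * q)%N.
Proof.
move/eqP; rewrite -(dvdn_pcharf hp) => /dvdnP[q ->].
by exists q; rewrite mulnC.
Qed.

(** Descent from index Mp by [mulS_central_bin]: the first step gains a factor p from k + 1 = Mp,
    and each step divides only by units mod p. *)
Lemma lead_central (M s : nat) : (0 < M)%N -> (0 < s <= p./2)%N ->
  lead 1 'C((M * p - s).*2, M * p - s)
    (- M%:R * ('C(M.*2, M))%:R / (s%:R * ('C(s.*2, s))%:R)).
Proof.
move=> M0; elim: s => // s IH hs.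
have Mp : (p <= M * p)%N by rewrite leq_pmull.
have div t : (0 < t <= p./2)%N ->
    exists q, 'C((M * p - t).*2, M * p - t) = (p * q)%N.
  move=> ht; apply: natr_eq0_dvd.
  have -> : (M * p - t = M.-1 * p + (p - t))%N by nia.
  by apply: central_bin_eq0; lia.
have [q eq] := div _ hs; exists q; first by rewrite expn1.
have two : 2 != 0 :> F by apply: (natr_pchar_neq0 hp); lia.
have [s0|s0] := posnP s.
  subst s; have := mulS_central_bin (M * p - 1).
  rewrite subn1 prednK; last lia.
  rewrite -subn1 eq => e.
  have {}e : (M * 'C((M * p).*2, M * p) = 2 * (M * p - 1).*2.+1 * q)%N.
    by apply/eqP; rewrite -(eqn_pmul2l (prime_gt0 p_pr)); apply/eqP; lia.
  have := congr1 (fun n => n%:R : F) e.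
  have -> : ((M * p - 1).*2.+1 = (M.*2.-1 * p + p.-1))%N by nia.
  rewrite !natrM natrDMp -subn1 natrB ?prime_gt0 // natrp0.
  have := central_bin_lucas M (leq0n _); rewrite addn0 bin0 mulr1 => -> e'.
  rewrite mulNr e' (_ : 'C(1.*2, 1) = 2%N) //; field; exact: two.
have hs' : (0 < s <= p./2)%N by lia.
have [y ey1 ey2] := IH hs'.
have := mulS_central_bin (M * p - s.+1).
have -> : (M * p - s.+1).+1 = (M * p - s)%N by lia.
rewrite eq ey1 => e.
have {}e : ((M * p - s) * y = 2 * (M * p - s.+1).*2.+1 * q)%N.
  by apply/eqP; rewrite -(eqn_pmul2l (prime_gt0 p_pr)); apply/eqP; lia.
have := congr1 (fun n => n%:R : F) e.
have -> : (M * p - s.+1).*2.+1 = (M.*2 * p - s.*2.+1)%N by lia.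
rewrite !natrM !natrB; [|lia..].
rewrite !natrM natrp0 !mulr0 !sub0r ey2 => {}e.
have := congr1 (fun n => n%:R : F) (mulS_central_bin s).
rewrite !natrM => ->.
have n1 : s%:R != 0 :> F by apply: (natr_pchar_neq0 hp); lia.
have n2 : (s.*2.+1)%:R != 0 :> F by apply: (natr_pchar_neq0 hp); lia.
have n3 : ('C(s.*2, s))%:R != 0 :> F.
  by apply: central_bin_neq0; lia.
move: e n2; move: (s.*2.+1)%:R => a e n2.
have -> : q%:R = - (2 * - a * q%:R) / (2 * a) by field; rewrite ?n2 ?two.
by rewrite -e; field; rewrite n1 n2 n3 two.
Qed.

(** Absorption k C(np,k) = np C(np-1,k-1) exhibits the factor p; Lucas evaluates the cofactor, np -
    1 having low digit p - 1. *)
Lemma lead_bin (n r s : nat) : (0 < n)%N -> (0 < s < p)%N ->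
  lead 1 'C(n * p, r * p + s) (- (-1) ^+ s * n%:R * ('C(n.-1, r))%:R / s%:R).
Proof.
move=> n0 hs.
have s0 := (natr_pchar_neq0 hp) hs.
have [q eq] : exists q, 'C(n * p, r * p + s) = (p * q)%N.
  apply: natr_eq0_dvd; rewrite -[(n * p)%N]addn0 (Lucas _ _ hp); [|lia..].
  by rewrite bin0n; case: s hs {s0} => // s _; rewrite mulr0.
exists q; first by rewrite expn1.
have := mul_bin_diag (n * p) (r * p + s.-1).
have -> : (r * p + s.-1).+1 = (r * p + s)%N by lia.
rewrite eq => e.
have {}e : (n * 'C((n * p).-1, r * p + s.-1) = (r * p + s) * q)%N.
  by apply/eqP; rewrite -(eqn_pmul2l (prime_gt0 p_pr)); apply/eqP; lia.
have := congr1 (fun n => n%:R : F) e.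
have -> : (n * p).-1 = (n.-1 * p + p.-1)%N by nia.
rewrite !natrM natrDMp (Lucas _ _ hp); [|lia..].
rewrite bin_pred_pchar; last by lia.
have -> : (-1) ^+ s = - (-1) ^+ s.-1 :> F.
  by case: s hs {s0 eq e} => // s _; rewrite exprS mulN1r.
rewrite opprK => {}e.
have -> : q%:R = (s%:R * q%:R) / s%:R :> F by field; exact: s0.
by rewrite -e; field; exact: s0.
Qed.

(** The factors C(2s,s) of the two central coefficients cancel. Lowering n - r to n - 1 - r by
    [mulS_central_bin] creates the weight that [S_weighted] sums. *)
Lemma lead_Sterm (n r s : nat) : (r < n)%N -> (0 < s <= p./2)%N ->
  lead 2 (Sterm (n * p) (r * p + s))
    ((-1) ^+ s / s%:R ^+ 2 *
     (2 * n%:R * (Sterm n.-1 r * (n.-1 - r).*2.+1)%:R)).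
Proof.
move=> rn hs; have hs' : (0 < s < p)%N by lia.
have n0 : (0 < n)%N by lia.
have nr : (0 < n - r)%N by lia.
have := lead_mul (lead_mul (lead_bin r n0 hs') (lead0 'C((r * p + s).*2, r * p + s)))
  (lead_central nr hs).
rewrite central_bin_lucas; last by lia.
have -> : ((n - r) * p - s = n * p - (r * p + s))%N by nia.
rewrite -/(Sterm _ _) addn0; congr (lead _ _ _).
have := congr1 (fun n => n%:R : F) (mulS_central_bin (n.-1 - r)).
have -> : (n.-1 - r).+1 = (n - r)%N by lia.
rewrite !natrM => e.
have s0 := (natr_pchar_neq0 hp) hs'.
have n3 : ('C(s.*2, s))%:R != 0 :> F.
  by apply: central_bin_neq0; lia.
transitivity ((-1 : F) ^+ s / s%:R ^+ 2 * n%:R * ('C(n.-1, r))%:R * ('C(r.*2, r))%:R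
  * ((n - r)%:R * ('C((n - r).*2, n - r))%:R)).
  by field; rewrite s0 n3.
by rewrite e; field; rewrite s0.
Qed.

(** The residues s and p - s contribute equally, so those up to (p-1)/2 are counted twice. With the
    factor n from [S_weighted] at n - 1 this makes 4n^2. *)
Lemma S_mul_split (n : nat) : (0 < n)%N ->
  exists2 q, S (n * p) = (\sum_(0 <= r < n.+1) Sterm (n * p) (r * p) + p ^ 2 * q)%N &
    q%:R = 4 * n%:R ^+ 2 * (S n.-1)%:R *
      (\sum_(1 <= s < p./2.+1) (-1) ^+ s / s%:R ^+ 2) :> F.
Proof.
move=> n0.
(* The reflection k -> np - k exchanges the residues s and p - s. *)
have inner s : (s <= p)%N -> (\sum_(0 <= r < n) Sterm (n * p) (r * p + (p - s)) =
    \sum_(0 <= r < n) Sterm (n * p) (r * p + s))%N.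
  move=> hs; rewrite big_nat_rev; apply: eq_big_nat => r hr.
  by rewrite -[RHS]Sterm_sym; [congr Sterm; nia | nia].
have -> : (S (n * p) = \sum_(0 <= r < n.+1) Sterm (n * p) (r * p) +
   2 * \sum_(1 <= s < p./2.+1) \sum_(0 <= r < n) Sterm (n * p) (r * p + s))%N.
  rewrite /S big_nat_recr //= -/(Sterm _ _) big_nat_blocks.
  under eq_bigr => r _ do rewrite -/(Sterm _ _) big_ltn ?prime_gt0 // addn0.
  rewrite big_split /= [in RHS]big_nat_recr //= -/(Sterm _ _) addnAC; congr addn.
  rewrite exchange_big /= (big_cat_nat _ (n := p./2.+1)) /=; [|lia..].
  rewrite mul2n -addnn; congr addn.
  rewrite -[p./2.+1 in LHS]add1n big_addn.
  have -> : (p - p./2 = p./2.+1)%N by lia.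
  rewrite big_nat_rev; apply: eq_big_nat => s hs.
  by rewrite -(inner s); [apply: eq_bigr => r _; congr Sterm; lia | lia].
pose c (s : nat) : F := (-1) ^+ s / s%:R ^+ 2.
have main : lead 2 (\sum_(1 <= s < p./2.+1) \sum_(0 <= r < n) Sterm (n * p) (r * p + s))
    (\sum_(1 <= s < p./2.+1) \sum_(0 <= r < n)
      c s * (2 * n%:R * (Sterm n.-1 r * (n.-1 - r).*2.+1)%:R)).
  apply: lead_sum => s; rewrite mem_index_iota => hs; apply: lead_sum => r.
  by rewrite mem_index_iota => hr; apply: lead_Sterm; lia.
have [q -> eq] := lead_mul (lead0 2) main; exists q; first by [].
rewrite eq.
rewrite !mulr_sumr; apply: eq_bigr => s _.
rewrite -!mulr_sumr -natr_sum.
by have := S_weighted n.-1; rewrite prednK // => ->; rewrite natrM /c; ring.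
Qed.
End CharP.

(** * Euler numbers *)

Lemma size_euler_even_seq (m : nat) : size (euler_even_seq m) = m.+1.
Proof. by elim: m => //= m IH; rewrite size_rcons IH. Qed.

(** The lists grow only at the end, so an entry does not depend on the list it is read from. *)
Lemma nth_euler_even_seq (m k : nat) : (k <= m)%N ->
  nth 0 (euler_even_seq m) k = Euler k.*2.
Proof.
rewrite /Euler odd_double doubleK; elim: m => [|m IH].
  by rewrite leqn0 => /eqP ->.
rewrite leq_eqVlt => /orP[/eqP -> //|km].
by rewrite /= nth_rcons size_euler_even_seq km IH.
Qed.

Lemma Euler_sum (m : nat) :
  \sum_(k < m.+1) ('C(m.*2, k.*2))%:Z * Euler k.*2 = (m == 0%N)%:Z.
Proof.
case: m => [|m]; first by rewrite big_ord_recr big_ord0.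
rewrite big_ord_recr /= binn mul1r -(@nth_euler_even_seq m.+1) //=.
rewrite nth_rcons size_euler_even_seq ltnn eqxx.
under eq_bigr => k _ do rewrite -(@nth_euler_even_seq m) -1?ltnS ?ltn_ord //.
by rewrite subrr.
Qed.

(* 2^(2m) times the Euler polynomial of degree 2m at (y + 1) / 2. *)
Definition euler_poly (R : comNzRingType) (m : nat) (y : R) : R :=
  \sum_(k < m.+1) ('C(m.*2, k.*2))%:R * (Euler k.*2)%:~R * y ^+ (m - k).*2.

(** Odd powers cancel. The sum runs to m instead of j, the extra binomials being 0, so that
    [euler_polyD1] can exchange sums with fixed bounds. *)
Lemma exprD1_even (R : comNzRingType) (j m : nat) (y : R) : (j <= m)%N ->
  (y + 1) ^+ j.*2 + (y - 1) ^+ j.*2 =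
  2 * \sum_(i < m.+1) ('C(j.*2, i.*2))%:R * y ^+ i.*2.
Proof.
have odd_even n (F : nat -> R) :
    \sum_(i < n.*2.+1) F i = \sum_(i < n.+1) F i.*2 + \sum_(i < n) F i.*2.+1.
  elim: n => [|n IH]; first by rewrite !big_ord_recr !big_ord0 /= addr0.
  rewrite doubleS !(big_ord_recr n.*2.+2, big_ord_recr n.*2.+1) /= IH.
  by rewrite (big_ord_recr n.+1) (big_ord_recr n) [X in _ = _ + X]big_ord_recr /= doubleS; ring.
move=> jm; rewrite [y + 1]addrC [y - 1]addrC !exprDn.
rewrite (odd_even j (fun i => 1 ^+ (j.*2 - i) * y ^+ i *+ 'C(j.*2, i))).
rewrite (odd_even j (fun i => (-1) ^+ (j.*2 - i) * y ^+ i *+ 'C(j.*2, i))).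
rewrite addrACA -!big_split /= [X in _ + X]big1 => [|i _]; last first.
  rewrite expr1n.
  have i_lt := ltn_ord i.
  have -> : (j.*2 - i.*2.+1 = (j - i.+1).*2.+1)%N by lia.
  by rewrite [(-1) ^+ _]exprS -[(j - i.+1).*2]mul2n exprM expr2 mulrNN mulr1 expr1n -mulrnDl -mulr_natl; ring.
rewrite addr0 mulr_sumr.
transitivity (\sum_(i < j.+1) 2 * (('C(j.*2, i.*2))%:R * y ^+ i.*2)).
  apply: eq_bigr => i _; rewrite expr1n.
  have -> : (j.*2 - i.*2 = (j - i).*2)%N by lia.
  by rewrite -[(j - i).*2]mul2n exprM expr2 mulrNN mulr1 expr1n -mulrnDl -mulr_natl; ring.
rewrite (big_ord_widen m.+1 (fun i => 2 * (('C(j.*2, i.*2))%:R * y ^+ i.*2))) //.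
rewrite big_mkcond; apply: eq_bigr => i _; case: ltnP => // ij.
by rewrite bin_small ?mul0r ?mulr0 //; lia.
Qed.

(** Both sides are the multinomial n!/(a! b! (n-a-b)!), or 0 when a + b > n. *)
Lemma bin_exchange (n a b : nat) :
  ('C(n, a) * 'C(n - a, b) = 'C(n, b) * 'C(n - b, a))%N.
Proof.
have [ab|ab] := leqP (a + b) n; last first.
  have [an|an] := leqP a n; have [bn|bn] := leqP b n.
  - rewrite [X in (_ * X)%N]bin_small; last lia.
    by rewrite [X in _ = (_ * X)%N]bin_small ?muln0 //; lia.
  - rewrite [X in (_ * X)%N]bin_small; last lia.
    by rewrite ['C(n, b)]bin_small ?muln0.
  - rewrite [X in _ = (_ * X)%N]bin_small; last lia.
    by rewrite ['C(n, a)]bin_small ?muln0.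
  - by rewrite !(bin_small an) !(bin_small bn).
have h1 : (a <= n)%N by lia.
have h2 : (b <= n - a)%N by lia.
have h3 : (b <= n)%N by lia.
have h4 : (a <= n - b)%N by lia.
have := bin_fact h1; rewrite -(bin_fact h2).
have := bin_fact h3; rewrite -(bin_fact h4).
have -> : (n - a - b = n - b - a)%N by lia.
have := fact_gt0 a; have := fact_gt0 b; have := fact_gt0 (n - b - a).
move: (a`!) (b`!) ((n - b - a)`!) => x y z z0 y0 x0 e1 e2.
apply/eqP; rewrite -(@eqn_pmul2r (x * y * z)) ?muln_gt0 ?x0 ?y0 //; apply/eqP.
transitivity (n`!); last by rewrite -e1; ring.
by rewrite -e2; ring.
Qed.

(** The functional equation E(x+1) + E(x) = 2 x^(2m) of Euler polynomials, rescaled. After the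
    exchange the inner sums are those of [Euler_sum], so only i = m survives. *)
Lemma euler_polyD1 (R : comNzRingType) (m : nat) (y : R) :
  euler_poly m (y + 1) + euler_poly m (y - 1) = 2 * y ^+ m.*2.
Proof.
rewrite /euler_poly -big_split /=.
transitivity (\sum_(k < m.+1) \sum_(i < m.+1)
    2 * y ^+ i.*2 * ('C(m.*2, i.*2))%:R *
      (('C((m - i).*2, k.*2))%:R * (Euler k.*2)%:~R)).
  apply: eq_bigr => k _.
  rewrite -mulrDr (@exprD1_even _ _ m) ?leq_subr // !mulr_sumr.
  apply: eq_bigr => i _.
  have := congr1 (fun n => n%:R : R) (bin_exchange m.*2 k.*2 i.*2).
  rewrite !natrM -!doubleB => h.
  transitivity (2 * y ^+ i.*2 * (Euler k.*2)%:~R *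
    (('C(m.*2, k.*2))%:R * ('C((m - k).*2, i.*2))%:R)); first by ring.
  by rewrite h; ring.
rewrite exchange_big /= big_ord_recr /= big1 => [|i _].
  rewrite add0r -mulr_sumr subnn /= big_ord_recl big1 => [|i _]; last first.
    by rewrite bin0n mul0r.
  by rewrite bin0 binn /Euler /= !mulr1 addr0 mulr1.
rewrite -mulr_sumr.
have i_lt := ltn_ord i.
have /= := congr1 (fun z : int => z%:~R : R) (Euler_sum (m - i)).
rewrite rmorph_sum /= => h.
rewrite (_ : \sum_(k < _) _ = 0) ?mulr0 //.
have z0 : (m - i == 0)%N%:Z%:~R = 0 :> R.
  by rewrite (_ : (m - i == 0)%N = false) //; apply/negbTE; lia.
rewrite z0 in h; rewrite -[RHS]h.
rewrite (big_ord_widen m.+1 (fun k => (('C((m - i).*2, k.*2))%:Z * Euler k.*2)%:~R)); last lia.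
rewrite [RHS]big_mkcond; apply: eq_bigr => k _; case: ltnP => hk.
  by rewrite intrM.
by rewrite bin_small ?mul0r //; lia.
Qed.

Lemma euler_poly1 (R : comNzRingType) (m : nat) : (0 < m)%N ->
  euler_poly m (1 : R) = 0.
Proof.
move=> m0; have /= := congr1 (fun z : int => z%:~R : R) (Euler_sum m).
rewrite rmorph_sum /= eqn0Ngt m0 /= mulr0z => h; rewrite -[RHS]h.
by apply: eq_bigr => k _; rewrite expr1n mulr1 intrM.
Qed.

Lemma euler_poly0 (R : comNzRingType) (m : nat) :
  euler_poly m (0 : R) = (Euler m.*2)%:~R.
Proof.
rewrite /euler_poly big_ord_recr /= big1 => [|k _].
  by rewrite subnn binn add0r mul1r mulr1.
by rewrite expr0n double_eq0 subn_eq0 leqNgt ltn_ord mulr0.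
Qed.

(** Telescoping by [euler_polyD1] at y = 2(h+1), which links the odd points 2h + 1 and 2h + 3; it
    starts from the zero at y = 1. *)
Lemma alt_sum_even_powers (R : comNzRingType) (m h : nat) : (0 < m)%N ->
  2 * (\sum_(1 <= s < h.+1) (-1) ^+ s * (s.*2)%:R ^+ m.*2) =
  (-1) ^+ h * euler_poly m (h.*2.+1)%:R :> R.
Proof.
move=> m0; elim: h => [|h IH]; first by rewrite big_geq // mulr0 euler_poly1 ?mulr0.
rewrite big_nat_recr //= mulrDr IH mulrCA -euler_polyD1.
have -> : (h.+1.*2)%:R + 1 = (h.+1.*2.+1)%:R :> R by rewrite natr1.
have -> : (h.+1.*2)%:R - 1 = (h.*2.+1)%:R :> R by rewrite doubleS -natr1 addrK.
by rewrite exprS; ring.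
Qed.

(** The telescoped sum ends at the point p, which is 0 in F, where the polynomial reduces to the
    Euler number. *)
Lemma alt_sum_inv_sqr (F : fieldType) (p : nat) : p \in [pchar F] ->
  odd p -> (3 < p)%N ->
  \sum_(1 <= s < p./2.+1) (-1) ^+ s / s%:R ^+ 2 =
  2 * (-1) ^+ (p./2) * (Euler (p - 3))%:~R :> F.
Proof.
move=> hp hodd p3; have p_pr := pcharf_prime hp.
have two : 2 != 0 :> F by apply: (natr_pchar_neq0 hp); lia.
pose m := (p - 3)./2.
have em : (m.*2 = p - 3)%N by rewrite /m; lia.
have := @alt_sum_even_powers F m p./2 ltac:(lia).
have -> : p./2.*2.+1 = p by lia.
rewrite (pcharf0 hp) euler_poly0 em => h.
have -> : 2 * (-1) ^+ p./2 * (Euler (p - 3))%:~R = 2 * ((-1) ^+ p./2 * (Euler (p - 3))%:~R) :> F by ring.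
rewrite -h mulrA mulr_sumr.
apply: eq_big_nat => s hs.
have s0 : s%:R != 0 :> F by apply: (natr_pchar_neq0 hp); lia.
(* Fermat for 2s gives (2s)^(p-3) = 1/(4 s^2); the 4 cancels against the two outer factors 2. *)
have := @natr_fermat F p s.*2 hp ltac:(lia).
have -> : p.-1 = (p - 3 + 2)%N by lia.
rewrite -muln2 natrM exprD => hf.
set z := (s%:R * 2) ^+ (p - 3).
rewrite -[LHS]mulr1 -[X in _ * X = _]hf -/z; field.
exact: s0.
Qed.

(** * Binomial coefficients modulo p^3 *)

(** Both sides are monic of degree p - 1 with the distinct roots -1, ..., -(p-1), by Fermat and
    since p - 1 is even. *)
Lemma rising_poly_pchar (F : fieldType) (p : nat) : p \in [pchar F] -> (2 < p)%N ->
  \prod_(1 <= i < p) ('X + (i%:R)%:P) = 'X^(p.-1) - 1 :> {poly F}.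
Proof.
move=> hp p2.
pose rs : seq F := [seq - i%:R | i <- index_iota 1 p].
have szrs : size rs = p.-1 by rewrite size_map size_iota subn1.
have p1 : (0 < p.-1)%N by lia.
have := @all_roots_prod_XsubC F ('X^(p.-1) - 1%:P) rs.
rewrite size_XnsubC // szrs lead_coefXnsubC // scale1r big_map => -> //.
- by apply: eq_bigr => i _; rewrite polyCN opprK.
- apply/allP=> _ /mapP[i hi ->]; rewrite mem_index_iota in hi.
  rewrite rootE !hornerE exprNn.
  have := hi; rewrite (natr_fermat hp) //.
  have p_pr := pcharf_prime hp.
  have : ~~ odd p.-1.
    by case: (even_prime p_pr) => [|po]; [lia | have := prime_gt1 p_pr; lia].
  by rewrite -signr_odd => /negbTE ->; rewrite mul1r subrr.
- rewrite uniq_rootsE map_inj_in_uniq ?iota_uniq // => i j.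
  rewrite !mem_index_iota => hi hj /oppr_inj.
  wlog ij : i j hi hj / (i <= j)%N.
    by move=> H; have [ij|/ltnW ij] := leqP i j; [exact: H | move/esym/H=> ->].
  move/esym/eqP; rewrite -subr_eq0 -natrB // -(dvdn_pcharf hp) => h.
  apply/eqP; rewrite eqn_leq ij leqNgt; apply/negP => lt.
  by move: h; rewrite gtnNdvd //; lia.
Qed.

Lemma horner_mod_cube (R : comNzRingType) (f : {poly R}) (x : R) :
  exists g, f.[x] = f`_0 + f`_1 * x + f`_2 * x ^+ 2 + x ^+ 3 * g.
Proof.
exists (drop_poly 3 f).[x].
rewrite -{1}(poly_take_drop 3 f) hornerD hornerM hornerXn horner_poly.
by rewrite !big_ord_recr big_ord0 /= !expr1 expr0; ring.
Qed.

(* For f = (X+1)...(X+p-1) = sum c_i X^i we have f(-p) = f(0), so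
   c_1 p = c_2 p^2 mod p^3, while p | c_2 because f = X^(p-1) - 1 mod p. *)
Lemma prod_block_mod_cube (p m : nat) : prime p -> (3 < p)%N ->
  exists q : int, (\prod_(1 <= i < p) (m * p + i))%N%:Z =
    (p.-1`!)%:Z + (p ^ 3)%N%:Z * q.
Proof.
move=> p_pr p3; have hp := pchar_Fp p_pr.
pose f : {poly int} := \prod_(1 <= i < p) ('X + (i%:Z)%:P).
have fE x : f.[x] = \prod_(1 <= i < p) (x + i%:Z).
  by rewrite horner_prod; apply: eq_bigr => i _; rewrite !hornerE.
have fact_prodZ : (p.-1`!)%:Z = \prod_(1 <= i < p) i%:Z.
  rewrite fact_prod prednK ?prime_gt0 //.
  exact: (big_morph Posz PoszM (erefl _)).
have c0 : f`_0 = (p.-1`!)%:Z.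
  by rewrite -horner_coef0 fE fact_prodZ; apply: eq_bigr => i _; rewrite add0r.
have [d ed] : exists d, f`_2 = p%:Z * d.
  have /dvdzP[d ->] : (p %| f`_2)%Z; last by exists d; rewrite mulrC.
  rewrite (dvdz_pcharf hp) -(coef_map (intr : int -> 'F_p)).
  rewrite rmorph_prod /=.
  under eq_bigr => i _ do rewrite map_polyXaddC /= -pmulrn.
  rewrite (rising_poly_pchar hp (ltnW p3)).
  rewrite coefB coefXn coef1 /= subr0 (_ : (2 == p.-1)%N = false) //.
  by apply/negbTE/eqP; lia.
have fN : f.[- p%:Z] = (p.-1`!)%:Z.
  rewrite fE big_nat_rev fact_prodZ.
  transitivity (\prod_(1 <= i < p) (- (1 : int) * i%:Z)).
    by apply: eq_big_nat => i hi; rewrite add1n subSS -subzn; [ring | lia].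
  rewrite big_split /= prodr_const_nat subn1 -signr_odd.
  have -> : odd p.-1 = false.
    by case: (even_prime p_pr) => [|po]; [lia | have := prime_gt1 p_pr; lia].
  by rewrite mul1r.
have [g eg] := horner_mod_cube f (- p%:Z); have [g' eg'] := horner_mod_cube f (m * p)%N%:Z.
have -> : (\prod_(1 <= i < p) (m * p + i))%N%:Z = f.[(m * p)%N%:Z].
  by rewrite fE (big_morph Posz PoszM (erefl _)); apply: eq_bigr => i _; rewrite PoszD.
rewrite fN c0 ed in eg; rewrite eg' c0 ed.
(* Collected from the expansion of f(mp), once [e1] has made its linear term divisible by p^3. *)
exists (m%:Z * d - m%:Z * g + m%:Z ^+ 2 * d + m%:Z ^+ 3 * g').
have e1 : f`_1 * p%:Z = p%:Z ^+ 3 * (d - g).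
  have : (p.-1`!)%:Z + f`_1 * p%:Z = (p.-1`!)%:Z + f`_1 * p%:Z by [].
  rewrite {1}eg => h; apply: (addrI (p.-1`!)%:Z); rewrite -h; ring.
have -> : f`_1 * (m * p)%N%:Z = m%:Z * (f`_1 * p%:Z) by rewrite PoszM; ring.
have -> : (p ^ 3)%N%:Z = p%:Z ^+ 3 by rewrite !expnS !PoszM; ring.
by rewrite e1 PoszM; ring.
Qed.

Lemma fact_addn (a b : nat) :
  (a + b)`! = (a`! * \prod_(1 <= i < b.+1) (a + i))%N.
Proof.
elim: b => [|b IH]; first by rewrite addn0 big_geq // muln1.
by rewrite addnS factS IH [in RHS]big_nat_recr //= addnS; ring.
Qed.

Lemma fact_mul_blocks (n p : nat) : (0 < p)%N ->
  (n * p)`! = (p ^ n * n`! *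
    \prod_(0 <= m < n) \prod_(1 <= i < p) (m * p + i))%N.
Proof.
move=> p0; elim: n => [|n IH]; first by rewrite big_geq.
rewrite mulSn addnC fact_addn IH big_nat_recr //= [in RHS]big_nat_recr //= factS expnS.
by rewrite mulSn [(n * p + p)%N]addnC; ring.
Qed.

(** The multiples of p in the factorials contribute p^n n! and cancel; [D] collects the other
    factors. *)
Lemma bin_mul_blocks (n r p : nat) : (0 < p)%N -> (r <= n)%N ->
  let D k := (\prod_(0 <= m < k) \prod_(1 <= i < p) (m * p + i))%N in
  ('C(n * p, r * p) * (D r * D (n - r)) = 'C(n, r) * D n)%N.
Proof.
move=> p0 rn D; have rpn : (r * p <= n * p)%N by rewrite leq_pmul2r.
have := bin_fact rpn; rewrite -mulnBl !fact_mul_blocks // -!/(D _) -(bin_fact rn).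
have -> : (p ^ n = p ^ r * p ^ (n - r))%N by rewrite -expnD subnKC.
move=> h; apply/eqP.
rewrite -(@eqn_pmul2l (p ^ r * p ^ (n - r) * (r`! * (n - r)`!))).
  by apply/eqP; move: h; rewrite ['C(n, r)]lock; lia.
by rewrite !muln_gt0 !expn_gt0 p0 !fact_gt0.
Qed.

(** Modulo p^3 every block is (p-1)!, so [D k] is its k-th power and cancels. *)
Lemma bin_mul_mod_cube (R : comUnitRingType) (p n r : nat) :
  prime p -> (3 < p)%N -> (p ^ 3)%:R = 0 :> R ->
  (p.-1`!)%:R \is a @GRing.unit R -> (r <= n)%N ->
  ('C(n * p, r * p))%:R = ('C(n, r))%:R :> R.
Proof.
move=> p_pr p3 p0 pU rn.
have := bin_mul_blocks (prime_gt0 p_pr) rn.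
set D := (fun k => _) => h.
have DE k : (D k)%:R = (p.-1`!)%:R ^+ k :> R.
  rewrite natr_prod -[k in RHS]subn0 -prodr_const_nat.
  apply: eq_bigr => m _; have [q] := prod_block_mod_cube m p_pr p3.
  move/(congr1 (fun z : int => z%:~R : R)).
  by rewrite rmorphD rmorphM /= -!pmulrn p0 mul0r addr0.
have := congr1 (fun k => k%:R : R) h.
rewrite !natrM !DE -exprD subnKC //; apply: mulIr.
exact: unitrX.
Qed.

(** * Primes greater than 3 *)

Lemma natr_Zp_eq0 (N k : nat) : (1 < N)%N -> k%:R = 0 :> 'Z_N -> (N %| k)%N.
Proof.
move=> N1 /(congr1 val); rewrite /= val_Zp_nat // => h.
by apply/eqP; rewrite h.
Qed.

Lemma Zp_eq_modz (N : nat) (a b : int) : (1 < N)%N ->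
  a%:~R = b%:~R :> 'Z_N -> (a = b %[mod N%:Z])%Z.
Proof.
move=> N1 /eqP; rewrite -subr_eq0 -rmorphB /= => h.
apply/eqP; rewrite eqz_mod_dvd dvdzE /=; apply: natr_Zp_eq0 => //.
move: h; case: (a - b) => k /eqP; rewrite ?NegzE ?rmorphN /= -pmulrn //.
by move/eqP; rewrite oppr_eq0 => /eqP.
Qed.

(** Multiples of p die against p^2; this carries identities from characteristic p to the ring with
    p^3 = 0. *)
Lemma sqr_pchar_lift (R : comNzRingType) (F : fieldType) (p : nat) (a b : int) :
  p \in [pchar F] -> (p%:R : R) ^+ 3 = 0 -> a%:~R = b%:~R :> F ->
  (p%:R : R) ^+ 2 * a%:~R = p%:R ^+ 2 * b%:~R.
Proof.
move=> hp p3 /eqP; rewrite -subr_eq0 -rmorphB /= -(dvdz_pcharf hp).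
move=> /dvdzP[c e]; have -> : a = b + c * p%:Z by rewrite -e addrC subrK.
rewrite rmorphD rmorphM /= -pmulrn.
have -> : (p%:R : R) ^+ 2 * (b%:~R + c%:~R * p%:R) =
  p%:R ^+ 2 * b%:~R + c%:~R * p%:R ^+ 3 by ring.
by rewrite p3 mulr0 addr0.
Qed.

Lemma S_rec_mul (R : comNzRingType) (n p : nat) : (0 < n)%N -> (0 < p)%N ->
  (n%:R * p%:R + 1) ^+ 2 * (S (n * p + 1))%:R
    + 32 * n%:R ^+ 2 * (p%:R ^+ 2 * (S (n * p - 1))%:R) =
  4 * (3 * n%:R ^+ 2 * p%:R ^+ 2 + 3 * n%:R * p%:R + 1) * (S (n * p))%:R :> R.
Proof.
move=> n0 p0; have np0 : (0 < n * p)%N by rewrite muln_gt0 n0.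
have := congr1 (fun k => k%:R : R) (S_rec np0).
rewrite -addn1 -subn1 !(natrD, natrM, natrX) => h.
transitivity ((n%:R * p%:R + 1) ^+ 2 * (S (n * p + 1))%:R
   + 32 * (n%:R * p%:R) ^+ 2 * (S (n * p - 1))%:R : R); first by ring.
by rewrite h; ring.
Qed.

(** As x^3 = 0, the inverse of x + 1 is 1 - x + x^2. *)
Lemma mulIr_1Dnil (R : comNzRingType) (x a b : R) : x ^+ 3 = 0 ->
  (x + 1) ^+ 2 * a = (x + 1) ^+ 2 * b -> a = b.
Proof.
move=> x3 e.
have h : (1 - x + x ^+ 2) ^+ 2 * (x + 1) ^+ 2 = 1.
  have -> : (1 - x + x ^+ 2) ^+ 2 * (x + 1) ^+ 2 = (1 + x ^+ 3) ^+ 2 by ring.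
  by rewrite x3 addr0 expr1n.
by rewrite -[a]mul1r -[b]mul1r -h -[LHS]mulrA -[RHS]mulrA e.
Qed.

Section MainCongruences.
Variables (R : comUnitRingType) (p n : nat).
Hypotheses (p_pr : prime p) (hodd : odd p) (n0 : (0 < n)%N).
Hypothesis p3 : (p%:R : R) ^+ 3 = 0.

Let hp : p \in [pchar 'F_p] := pchar_Fp p_pr.

Lemma S_pred_lift :
  (p%:R : R) ^+ 2 * (S (n * p - 1))%:R =
  p%:R ^+ 2 * ((-1) ^+ p./2 * (S n.-1)%:R).
Proof.
have := @sqr_pchar_lift R _ p (S (n * p - 1))%:Z ((-1) ^+ p./2 * (S n.-1)%:Z) hp p3.
rewrite !rmorphM !rmorphXn !rmorphN1 /= -!pmulrn; apply.
exact: S_pred_mul.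
Qed.

Lemma S_mul_lift : (3 < p)%N -> (p.-1`!)%:R \is a @GRing.unit R ->
  (S (n * p))%:R = (S n)%:R + p%:R ^+ 2 *
    (8 * n%:R ^+ 2 * (S n.-1)%:R * ((-1) ^+ p./2 * (Euler (p - 3))%:~R)) :> R.
Proof.
move=> gt3 pU; have p30 : (p ^ 3)%:R = 0 :> R by rewrite natrX.
have [q -> eq] := S_mul_split hp hodd n0.
rewrite natrD natr_sum; congr (_ + _).
  rewrite /S natr_sum; apply: eq_big_nat => r hr.
  rewrite -/(Sterm _ _) /Sterm -mulnBl !doubleMl !natrM !(bin_mul_mod_cube p_pr gt3 p30 pU) //; lia.
rewrite natrM natrX.
have := @sqr_pchar_lift R _ p q%:Z
  (8 * n%:Z ^+ 2 * (S n.-1)%:Z * ((-1) ^+ p./2 * Euler (p - 3))) hp p3.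
rewrite !rmorphM !rmorphXn !rmorphN1 /= -!pmulrn; apply.
by rewrite eq alt_sum_inv_sqr //; ring.
Qed.

Lemma S_mul_succ : (3 < p)%N -> (p.-1`!)%:R \is a @GRing.unit R ->
  (S (n * p + 1))%:R = 4 * (n%:R * p%:R + 1) * (S n)%:R +
    32 * n%:R ^+ 2 * (S n.-1)%:R * (-1) ^+ p./2 * ((Euler (p - 3))%:~R - 1)
      * p%:R ^+ 2 :> R.
Proof.
move=> gt3 pU; have x3 : (n%:R * p%:R) ^+ 3 = 0 :> R by rewrite exprMn p3 mulr0.
apply: (mulIr_1Dnil x3).
have := @S_rec_mul R n p n0 (prime_gt0 p_pr).
rewrite S_pred_lift S_mul_lift //.
move: (S _)%:R (S n)%:R (S n.-1)%:R (Euler _)%:~R ((-1) ^+ _) (n%:R) (p%:R : R) p3.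
move=> s s1 s0 e c x y y3 h.
have {h} -> : (x * y + 1) ^+ 2 * s = 4 * (3 * x ^+ 2 * y ^+ 2 + 3 * x * y + 1) *
    (s1 + y ^+ 2 * (8 * x ^+ 2 * s0 * (c * e))) -
    32 * x ^+ 2 * (y ^+ 2 * (c * s0)) by rewrite -h addrK.
apply/eqP; rewrite -subr_eq0; apply/eqP.
(* The difference of the two sides, with its factor p^3 made explicit. *)
transitivity (y ^+ 3 * (32 * x ^+ 3 * s0 * c * (e * (2 * x * y + 1) + (x * y + 2)) - 4 * s1 * x ^+ 3)).
  by ring.
by rewrite y3 mul0r.
Qed.
End MainCongruences.

(** * The prime 3 *)

Lemma sum_mulnS (k : nat) : (3 * (\sum_(0 <= m < k) m * m.+1) + k = k ^ 3)%N.
Proof.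
elim: k => [|k IH]; first by rewrite big_geq.
by rewrite big_nat_recr //= !expnS expn0 in IH *; lia.
Qed.

(** Only n = 3a + 2 is not trivial; there the recurrences at 3a and 3a + 1 give S_(3a+1) = S_(3a)
    and S_(3a+2) = -S_(3a). *)
Lemma S_add_pred_pchar3 (F : fieldType) (n : nat) : 3 \in [pchar F] -> (0 < n)%N ->
  n%:R * (n%:R - 1) * ((S n)%:R + (S n.-1)%:R) = 0 :> F.
Proof.
move=> h3 n0; have F3 : 3 = 0 :> F := pcharf0 h3.
have nE := divn_eq n 3; have n3 := ltn_pmod n (isT : 0 < 3)%N.
have -> : n%:R = (n %% 3)%:R :> F by rewrite {1}nE (natrDMp h3).
move: n3 nE; case: (n %% 3)%N => [|[|[|//]]] _ nE; first by rewrite !mul0r.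
  by rewrite subrr mulr0 mul0r.
move: (n %/ 3)%N nE => a ->; rewrite addn2 /=.
have a3 : (a * 3)%:R = 0 :> F by rewrite natrM F3 mulr0.
have rec k : (0 < k)%N -> k.+1%:R ^+ 2 * (S k.+1)%:R + 32 * k%:R ^+ 2 * (S k.-1)%:R =
    4 * (3 * k%:R ^+ 2 + 3 * k%:R + 1) * (S k)%:R :> F.
  by move=> /S_rec /(congr1 (fun i => i%:R : F)); rewrite !(natrD, natrM, natrX).
have s1 : (S (a * 3).+1)%:R = (S (a * 3))%:R :> F.
  (* The recurrence starts at index 1, so a = 0 is read off from S_0 = 1 and S_1 = 4. *)
  case: (posnP a) => [->|a0].
    rewrite mul0n /S !big_mkord !big_ord_recr !big_ord0 /=.
    transitivity (3 + 1 : F); [by rewrite natr1 | by rewrite F3 add0r].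
  have := rec (a * 3)%N; rewrite -[(a * 3).+1%:R]natr1 a3 muln_gt0 a0 => /(_ isT).
  rewrite !expr0n /= !mulr0 mul0r addr0 !add0r expr1n mul1r mulr1 => ->.
  transitivity (3 * (S (a * 3))%:R + (S (a * 3))%:R : F); first by ring.
  by rewrite F3 mul0r add0r.
have := rec (a * 3).+1 isT; rewrite /= s1 -[(a * 3).+2%:R]natr1 -[(a * 3).+1%:R]natr1 a3.
move: (S _)%:R (S _)%:R => s0 s2; rewrite !add0r => h.
have {}h : 4 * s2 + 32 * s0 = 4 * 7 * s0 by transitivity (4 * (3 * 1 ^+ 2 + 3 * 1 + 1) * s0); [rewrite -h; ring | ring].
transitivity (2 * (4 * s2 + 32 * s0 - 4 * 7 * s0) - 3 * (2 * s0 + 2 * s2)); first by ring.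
by rewrite h F3; ring.
Qed.

Section ModTwentySeven.
Variable R : comUnitRingType.
Hypothesis R27 : 27 = 0 :> R.

Lemma mulr9_eq (x y z : R) : x = y + 3 * z -> 9 * x = 9 * y.
Proof.
move=> ->; have -> : 9 * (y + 3 * z) = 9 * y + 27 * z by ring.
by rewrite R27 mul0r addr0.
Qed.

Lemma mulr9_cube (r : nat) : 9 * r%:R ^+ 3 = 9 * r%:R :> R.
Proof.
apply: (@mulr9_eq _ _ (\sum_(0 <= m < r) m * m.+1)%N%:R).
by rewrite -natrX -sum_mulnS natrD natrM addrC.
Qed.

(** A block is 2 + 9k(k+1) = 2(1 - 9k(k+1)) mod 27, so [D k] is 2^k (1 - 9 g(k)) with g(k) = (k^3 -
    k)/3. The correction is the failure of g to be additive. *)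
Lemma bin_mul3 (r m : nat) :
  ('C((r + m) * 3, r * 3))%:R =
  ('C(r + m, r))%:R * (1 - 9 * ((r + m)%:R * r%:R * m%:R)) :> R.
Proof.
have := bin_mul_blocks (isT : 0 < 3)%N (leq_addr m r); rewrite addKn.
set D := (fun k => _).
pose g k := (\sum_(0 <= i < k) i * i.+1)%N.
have DE k : (D k)%:R = 2 ^+ k * (1 - 9 * (g k)%:R) :> R.
  rewrite /D /g; elim: k => [|k IH]; first by rewrite !big_geq // expr0; ring.
  rewrite big_nat_recr //= natrM IH [in RHS]big_nat_recr //=.
  have -> : (\prod_(1 <= i < 3) (k * 3 + i) = (k * 3 + 1) * (k * 3 + 2))%N.
    by rewrite big_ltn // big_nat1.
  rewrite !(natrD, natrM) -[k.+1%:R]natr1 exprS.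
  move: (\sum_(_ <= _ < _) _)%N%:R (k%:R) (2 ^+ k) => x y c.
  transitivity (2 * c * (1 - 9 * (x + y * (y + 1))) +
    27 * (c * (y ^+ 2 + y - x * (3 * y ^+ 2 + 3 * y)))); first by ring.
  by rewrite R27 mul0r addr0.
have gE : (g (r + m) = g r + g m + (r + m) * r * m)%N.
  have := sum_mulnS (r + m); have := sum_mulnS r; have := sum_mulnS m.
  by rewrite -!/(g _) !expnS !expn0; nia.
move/(congr1 (fun k => k%:R : R)); rewrite !natrM !DE exprD gE natrD [in RHS]natrD.
rewrite !natrM.
(* 14 is the inverse of 2 modulo 27. *)
have h2 k : 2 ^+ k * 14 ^+ k = 1 :> R.
  rewrite -exprMn (_ : 2 * 14 = 1) ?expr1n //.
  transitivity (27 + 1 : R); [by ring | by rewrite R27 add0r].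
move: (h2 r) (h2 m).
move: (2 ^+ r) (14 ^+ r) (2 ^+ m) (14 ^+ m) (g r)%:R (g m)%:R => a a' b b' x y ha hb.
move: ('C(_, _))%:R ('C(_, _))%:R (_%:R * _%:R * _%:R) => C' C z e.
have k1 : (1 + 9 * (x + y)) * ((1 - 9 * x) * (1 - 9 * y)) = 1.
  transitivity (1 + 27 * (3 * x * y * (1 + 9 * (x + y)) - 3 * (x + y) ^+ 2)); first by ring.
  by rewrite R27 mul0r addr0.
have k2 : (1 + 9 * (x + y)) * (1 - 9 * (x + y + z)) = 1 - 9 * z.
  transitivity (1 - 9 * z - 27 * (3 * (x + y) * (x + y + z))); first by ring.
  by rewrite R27 mul0r subr0.
transitivity ((a * a') * (b * b') * ((1 + 9 * (x + y)) * ((1 - 9 * x) * (1 - 9 * y))) * C).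
  by rewrite ha hb k1 !mul1r.
transitivity ((a' * b' * (1 + 9 * (x + y))) * (C * (a * (1 - 9 * x) * (b * (1 - 9 * y))))).
  by ring.
rewrite e.
transitivity ((a * a') * (b * b') * C' * ((1 + 9 * (x + y)) * (1 - 9 * (x + y + z)))).
  by ring.
by rewrite ha hb k2 !mul1r.
Qed.

(** With m = n - r the three binomials bring the corrections nrm, 2r^3 and 2m^3; times 9, the cubes
    become r and m, with sum n. *)
Lemma Sterm_mul3 (n r : nat) : (r <= n)%N ->
  (Sterm (n * 3) (r * 3))%:R =
  (Sterm n r)%:R - 9 * (n%:R * (r * (n - r) * Sterm n r)%N%:R + 2 * n%:R * (Sterm n r)%:R) :> R.
Proof.
move=> /subnKC <-; move: (n - r)%N => m.
rewrite /Sterm -mulnBl !addKn !doubleMl -!addnn !natrM !bin_mul3 !natrD.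
have := mulr9_cube r; have := mulr9_cube m.
move: ('C(_, _))%:R ('C(_, _))%:R ('C(_, _))%:R (r%:R) (m%:R) => A B C x y hy hx.
pose P := (x + y) * x * y; pose Q := x ^+ 3; pose T := y ^+ 3.
transitivity (A * B * C * (1 - 9 * P - 2 * (9 * x ^+ 3) - 2 * (9 * y ^+ 3)) +
   27 * (A * B * C * (3 * (2 * P * Q + 2 * P * T + 4 * Q * T) - 27 * 4 * P * Q * T))).
  by rewrite /P /Q /T; ring.
by rewrite R27 hx hy /P; ring.
Qed.

Lemma S_mul_lift3 (n : nat) : (0 < n)%N ->
  (S (n * 3))%:R = (S n)%:R - 9 * n%:R ^+ 2 * ((S n)%:R + 2 * (S n.-1)%:R) :> R.
Proof.
move=> n0; have p_pr : prime 3 by [].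
have R3 : (3 : R) ^+ 3 = 0 by rewrite -R27; ring.
have [q -> eq] := S_mul_split (pchar_Fp p_pr) isT n0.
have {}eq : 9 * q%:R = - 9 * (4 * n%:R ^+ 2 * (S n.-1)%:R) :> R.
  have := @sqr_pchar_lift R _ 3 q%:Z (- (4 * n%:Z ^+ 2 * (S n.-1)%:Z)) (pchar_Fp p_pr) R3.
  rewrite !(rmorphN, rmorphM, rmorphXn) /= -!pmulrn => H.
  have -> : 9 * q%:R = 3 ^+ 2 * q%:R :> R by ring.
  rewrite H; first by ring.
  (* For p = 3 the alternating sum has the single term s = 1, equal to -1. *)
  by rewrite eq big_nat1 expr1 expr1n; field; exact: oner_neq0.
rewrite natrD natr_sum natrM natrX.
have -> : 3 ^+ 2 * q%:R = 9 * q%:R :> R by ring.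
rewrite eq.
under eq_big_nat => r hr do rewrite Sterm_mul3 //.
rewrite sumrB -mulr_sumr big_split /= -!mulr_sumr -!natr_sum -/(S n).
have := congr1 (fun k => k%:R : R) (S_moment n0).
rewrite !(natrD, natrM, natrX).
move: (\sum_(_ <= _ < _) _)%N%:R => w hw.
have h0 : 9 * (n%:R * (n%:R - 1) * ((S n)%:R + (S n.-1)%:R)) = 0 :> R.
  have := @sqr_pchar_lift R _ 3 (n%:Z * (n%:Z - 1) * ((S n)%:Z + (S n.-1)%:Z)) 0
    (pchar_Fp p_pr) R3.
  rewrite !(rmorphM, rmorphB, rmorphD) rmorph1 mulr0z mulr0 /= -!pmulrn => H.
  by rewrite -[RHS]H ?S_add_pred_pchar3 //; ring.
move: (mulr9_cube n) h0 hw; move: (n%:R) (S n)%:R (S n.-1)%:R => x s s' x3 h0 hw.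
have {}hw : 2 * w = x ^+ 2 * s - 4 * x ^+ 2 * s' by rewrite -hw addrK.
(* The target plus multiples of the four known relations: [h0], n^3 = n under 9, the moment identity
   and 27 = 0. *)
transitivity (s - 9 * x ^+ 2 * (s + 2 * s') + 9 * (x * (x - 1) * (s + s'))
   + (9 * x ^+ 3) * (s - 4 * s') - 9 * x * (s - 4 * s')
   + 9 * x * (2 * w - (x ^+ 2 * s - 4 * x ^+ 2 * s'))
   - 27 * (x * w + x * s' + x ^+ 2 * s')); first by ring.
by rewrite h0 x3 hw R27; ring.
Qed.

(** The terms in S_(n-1) cancel modulo 27: their n^2 coefficient is -72 + 288 = 216. *)
Lemma S_mul_succ3 (n : nat) : (0 < n)%N ->
  (S (n * 3 + 1))%:R = (4 + 12 * n%:R - 9 * n%:R ^+ 2) * (S n)%:R :> R.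
Proof.
move=> n0; have p_pr : prime 3 by [].
have R3 : (3 : R) ^+ 3 = 0 by rewrite -R27; ring.
have x3 : (n%:R * 3) ^+ 3 = 0 :> R by rewrite exprMn R3 mulr0.
apply: (mulIr_1Dnil x3).
have := @S_rec_mul R n 3 n0 isT.
rewrite (S_pred_lift p_pr isT n0 R3) S_mul_lift3 //= expr1.
move: (S _)%:R (S n)%:R (S n.-1)%:R (n%:R : R) => s s1 s0 x h.
have {h} -> : (x * 3 + 1) ^+ 2 * s = 4 * (3 * x ^+ 2 * 3 ^+ 2 + 3 * x * 3 + 1) *
    (s1 - 9 * x ^+ 2 * (s1 + 2 * s0)) - 32 * x ^+ 2 * (3 ^+ 2 * (-1 * s0)).
  by rewrite -h addrK.
transitivity ((x * 3 + 1) ^+ 2 * ((4 + 12 * x - 9 * x ^+ 2) * s1) +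
  27 * ((- x ^+ 2 - 14 * x ^+ 3 - 33 * x ^+ 4) * s1 +
        (8 * x ^+ 2 - 24 * x ^+ 3 - 72 * x ^+ 4) * s0)); first by ring.
by rewrite R27 mul0r addr0.
Qed.

End ModTwentySeven.

(** * Both cases, read in the ring Z/p^3 *)

Theorem theorem3p4 (p n : nat) (hp : prime p) (hodd : odd p) (hn : (0 < n)%N) :
  (p = 3%N ->
     ((S (n * p + 1))%:Z = (4 + 12 * n%:Z - 9 * n%:Z ^+ 2) * (S n)%:Z
        %[mod (p ^ 3)%N%:Z])%Z) /\
  ((3 < p)%N ->
     ((S (n * p + 1))%:Z =
        4 * (n * p + 1)%N%:Z * (S n)%:Z
        + 32 * n%:Z ^+ 2 * (S (n - 1))%:Z * (-1) ^+ ((p - 1) %/ 2)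
          * (Euler (p - 3) - 1) * p%:Z ^+ 2
        %[mod (p ^ 3)%N%:Z])%Z).
Proof.
have p1 := prime_gt1 hp.
have p31 : (1 < p ^ 3)%N by rewrite (ltn_exp2l 0).
have pR : (p%:R : 'Z_(p ^ 3)) ^+ 3 = 0 by rewrite -natrX pchar_Zp.
split=> [p3|p3]; apply: Zp_eq_modz => //.
  subst p; rewrite -pmulrn S_mul_succ3 //; last by rewrite -pR; ring.
  by rewrite !(rmorphD, rmorphB, rmorphM, rmorphXn) /= -!pmulrn; ring.
(* (p-1)! is prime to p, hence invertible modulo p^3. *)
have pU : (p.-1`!)%:R \is a @GRing.unit 'Z_(p ^ 3).
  rewrite unitZpE // coprimeXl // prime_coprime // (dvdn_pcharf (pchar_Fp hp)).
  by apply: (fact_pchar_neq0 (pchar_Fp hp)); lia.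
rewrite -pmulrn (S_mul_succ hp hodd hn pR p3 pU).
have -> : ((p - 1) %/ 2 = p./2)%N by rewrite divn2; lia.
rewrite subn1 PoszD PoszM.
rewrite !(rmorphD, rmorphB, rmorphM, rmorphXn, rmorphN1) rmorph1 /= -!pmulrn; ring.
Qed.
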